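(* Let $C$ be a right semiperfect coalgebra over a field $k$. Let $M$ and $N$ be left $C$-comodules, and let $i:{}^C\mathcal{M}\to \mathrm{Mod}(C^* )$ be the inclusion functor. Then $N$ is a dual $M$-CS-Rickart left $C$-comodule if and only if $i(N)$ is a dual $i(M)$-CS-Rickart right $C^*$-module.
   Context: In an abelian category: a morphism $r:A\to B$ is a retraction if there is $r':B\to A$ with $rr'=1_B$. An epimorphism $f:X\to Y$ is superfluous if for every morphism $h:P\to X$ such that $fh$ is an epimorphism, $h$ is an epimorphism. For objects $M,N$ of an abelian category, $N$ is dual $M$-CS-Rickart if for every morphism $f:M\to N$ there are a retraction $r:N\to P$ and a superfluous epimorphism $t:P\to \mathrm{Coker}(f)$ with $\mathrm{coker}(f)=tr$. ${}^C\mathcal{M}$ is the category of left $C$-comodules, a Grothendieck category; $C^*=\mathrm{Hom}_k(C,k)$ is the dual (convolution) algebra and $\mathrm{Mod}(C^* )$ is the category of right $C^*$-modules. A left $C$-comodule $M$ with coaction $m\mapsto \sum m_{(-1)}\otimes m_{(0)}$ is a right $C^*$-module via $m\cdot f=\sum f(m_{(-1)})m_{(0)}$; in this way left $C$-comodules are identified with the rational right $C^*$-modules (a full subcategory of $\mathrm{Mod}(C^* )$), and $i$ denotes the resulting inclusion functor. A coalgebra $C$ is right semiperfect if the category of right $C$-comodules has enough projectives. ''Dual $M$-CS-Rickart left $C$-comodule'' (resp. right $C^*$-module) means in the category ${}^C\mathcal{M}$ (resp. $\mathrm{Mod}(C^* )$). *)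

(* Defs.v *)
From HB Require Import structures.
From mathcomp Require Import all_boot all_algebra.
From mathcomp Require Import boolp.

Set Implicit Arguments.
Unset Strict Implicit.
Unset Printing Implicit Defensive.

Import GRing.Theory.
Local Open Scope ring_scope.
Local Open Scope quotient_scope.

(* Only the zero morphisms of an abelian category are needed to speak of
   cokernels, so the notions below are set in categories with zero morphisms. *)
Record category := Category {
  Obj :> Type;
  Hom : Obj -> Obj -> Type;
  idm : forall A, Hom A A;
  comp : forall A B D, Hom B D -> Hom A B -> Hom A D;
  zerom : forall A B, Hom A B;
  comp_assoc : forall A B D E (h : Hom D E) (g : Hom B D) (f : Hom A B),
    comp h (comp g f) = comp (comp h g) f;
  comp_idl : forall A B (f : Hom A B), comp (idm B) f = f;
  comp_idr : forall A B (f : Hom A B), comp f (idm A) = f;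
  comp_zerol : forall A B D (f : Hom A B), comp (zerom B D) f = zerom A D;
  comp_zeror : forall A B D (g : Hom B D), comp g (zerom A B) = zerom A D
}.

Arguments Hom {c}.
Arguments idm {c}.
Arguments comp {c A B D}.
Arguments zerom {c}.

Notation "g \oc f" := (comp g f) (at level 50, left associativity).

Section CategoryNotions.
Variable A : category.

Definition epi (X Y : A) (f : Hom X Y) : Prop :=
  forall (Z : A) (g h : Hom Y Z), g \oc f = h \oc f -> g = h.

Definition retraction (X Y : A) (r : Hom X Y) : Prop :=
  exists r' : Hom Y X, r \oc r' = idm Y.

Definition superfluous (X Y : A) (f : Hom X Y) : Prop :=
  epi f /\ forall (P : A) (h : Hom P X), epi (f \oc h) -> epi h.

Definition is_cokernel (X Y Q : A) (f : Hom X Y) (q : Hom Y Q) : Prop :=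
  q \oc f = zerom X Q /\
  forall (Z : A) (g : Hom Y Z), g \oc f = zerom X Z ->
    exists! u : Hom Q Z, u \oc q = g.

(* Cokernels are unique up to isomorphism, so the choice of [q] is immaterial. *)
Definition dual_CS_Rickart (M N : A) : Prop :=
  forall f : Hom M N,
  exists (Q : A) (q : Hom N Q), is_cokernel f q /\
  exists (P : A) (r : Hom N P) (t : Hom P Q),
    [/\ retraction r, superfluous t & q = t \oc r].

Definition projective (P : A) : Prop :=
  forall (X Y : A) (e : Hom X Y) (g : Hom P Y), epi e ->
    exists h : Hom P X, e \oc h = g.

Definition enough_projectives : Prop :=
  forall X : A, exists (P : A) (e : Hom P X), projective P /\ epi e.

End CategoryNotions.

Record functor (A B : category) := Functor {
  Fobj :> A -> B;
  Fmap : forall X Y : A, Hom X Y -> Hom (Fobj X) (Fobj Y);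
  Fmap_id : forall X : A, Fmap (idm X) = idm (Fobj X);
  Fmap_comp : forall (X Y Z : A) (g : Hom Y Z) (f : Hom X Y),
    Fmap (g \oc f) = Fmap g \oc Fmap f
}.

Lemma linear_ext (R : pzRingType) (U : lmodType R) (V : zmodType)
  (s : R -> V -> V) (f g : {linear U -> V | s}) : f =1 g -> f = g.
Proof.
case: f g => f [[Hf1] [Hf2]] [g [[Hg1] [Hg2]]] /= /funext fg; subst g.
by rewrite (Prop_irrelevance Hf1 Hg1) (Prop_irrelevance Hf2 Hg2).
Qed.

(* A right [R]-module is a left module over the converse ring [R^c]. *)
Section RightModules.
Variable R : pzRingType.

Definition right_module_category : category.
Proof.
refine (@Category (lmodType R^c) (fun M N => {linear M -> N})
  (fun M => idfun : {linear M -> M})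
  (fun L M N (g : {linear M -> N}) (f : {linear L -> M}) =>
     (g \o f : {linear L -> N}))
  (fun M N => (\0 : {linear M -> N})) _ _ _ _ _).
- by move=> *; apply: linear_ext.
- by move=> *; apply: linear_ext.
- by move=> *; apply: linear_ext.
- by move=> *; apply: linear_ext.
- by move=> L M N g; apply: linear_ext => x /=; exact: raddf0.
Defined.

End RightModules.

(* V (x) W is the free commutative monoid on V * W (sequences up to order)
   modulo the usual bilinearity relations.  Opposites being absent from a free
   monoid, [(0, w) ~ 0] is added as a generating relation; the quotient is then
   a group, with [- (v (x) w) = (- v) (x) w]. *)
Section Tensor.
Variables (k : fieldType) (V W : lmodType k).

Inductive tens_eq : seq (V * W) -> seq (V * W) -> Prop :=
| TensRefl s : tens_eq s s
| TensSym s t : tens_eq s t -> tens_eq t s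
| TensTrans t s u : tens_eq s t -> tens_eq t u -> tens_eq s u
| TensCat s s' t t' : tens_eq s s' -> tens_eq t t' ->
    tens_eq (s ++ t) (s' ++ t')
| TensCatC s t : tens_eq (s ++ t) (t ++ s)
| TensAddl v v' w : tens_eq [:: (v + v', w)] [:: (v, w); (v', w)]
| TensAddr v w w' : tens_eq [:: (v, w + w')] [:: (v, w); (v, w')]
| TensScale a v w : tens_eq [:: (a *: v, w)] [:: (v, a *: w)]
| TensZero w : tens_eq [:: (0, w)] [::].

Definition tens_rel (s t : seq (V * W)) : bool := `[< tens_eq s t >].

Lemma tens_rel_refl : reflexive tens_rel.
Proof. by move=> s; apply/asboolP; exact: TensRefl. Qed.

Lemma tens_rel_sym : symmetric tens_rel.
Proof. by move=> s t; apply/asboolP/asboolP; exact: TensSym. Qed.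

Lemma tens_rel_trans : transitive tens_rel.
Proof.
by move=> t s u /asboolP st /asboolP tu; apply/asboolP; exact: TensTrans tu.
Qed.

Canonical tens_equiv :=
  EquivRel tens_rel tens_rel_refl tens_rel_sym tens_rel_trans.

Definition tensor : Type := {eq_quot tens_rel}.

HB.instance Definition _ : EqQuotient _ tens_rel tensor := EqQuotient.on tensor.
HB.instance Definition _ := Choice.on tensor.

Definition tens_sum (s : seq (V * W)) : tensor := \pi s.
Definition tens (v : V) (w : W) : tensor := tens_sum [:: (v, w)].

Lemma tens_sumP s t : tens_sum s = tens_sum t <-> tens_eq s t.
Proof.
split; first by move/eqmodP => /asboolP.
by move=> st; apply/eqmodP/asboolP.
Qed.

Lemma tens_sumK x : tens_sum (repr x) = x.
Proof. exact: reprK. Qed.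

Lemma tens_reprK s : tens_eq (repr (tens_sum s)) s.
Proof. by apply/tens_sumP; rewrite tens_sumK. Qed.

Definition tzero : tensor := tens_sum [::].
Definition tadd (x y : tensor) : tensor := tens_sum (repr x ++ repr y).
Definition tscale (a : k) (x : tensor) : tensor :=
  tens_sum [seq (a *: p.1, p.2) | p <- repr x].
Definition topp (x : tensor) : tensor := tscale (-1) x.

Lemma tadd_sum s t : tadd (tens_sum s) (tens_sum t) = tens_sum (s ++ t).
Proof. by apply/tens_sumP; apply: TensCat; exact: tens_reprK. Qed.

Lemma tens_eq_scale a s t : tens_eq s t ->
  tens_eq [seq (a *: p.1, p.2) | p <- s] [seq (a *: p.1, p.2) | p <- t].
Proof.
elim=> {s t} [s|s t _|t s u _ st _ tu|s s' t t' _ IHs _ IHt|s t|v v' w|v w w'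
  |b v w|w] /=.
- exact: TensRefl.
- exact: TensSym.
- exact: TensTrans tu.
- by rewrite !map_cat; exact: TensCat.
- by rewrite !map_cat; exact: TensCatC.
- by rewrite scalerDr; exact: TensAddl.
- exact: TensAddr.
- by rewrite scalerA mulrC -scalerA; exact: TensScale.
- by rewrite scaler0; exact: TensZero.
Qed.

Lemma tscale_sum a s :
  tscale a (tens_sum s) = tens_sum [seq (a *: p.1, p.2) | p <- s].
Proof. by apply/tens_sumP; apply: tens_eq_scale; exact: tens_reprK. Qed.

Lemma taddA : associative tadd.
Proof.
move=> x y z; rewrite -(tens_sumK x) -(tens_sumK y) -(tens_sumK z).
by rewrite !tadd_sum catA.
Qed.

Lemma taddC : commutative tadd.
Proof.
move=> x y; rewrite -(tens_sumK x) -(tens_sumK y) !tadd_sum.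
by apply/tens_sumP; exact: TensCatC.
Qed.

Lemma tadd0 : left_id tzero tadd.
Proof. by move=> x; rewrite -(tens_sumK x) tadd_sum. Qed.

Lemma tscaleDl x : {morph tscale^~ x : a b / a + b >-> tadd a b}.
Proof.
move=> a b; rewrite -(tens_sumK x) !tscale_sum tadd_sum; apply/tens_sumP.
elim: (repr x) => [|[v w] s IHs] /=; first exact: TensRefl.
rewrite -cat1s -(cat1s (a *: v, w)) -(cat1s (b *: v, w)).
apply: (@TensTrans (([:: (a *: v, w)] ++ [:: (b *: v, w)]) ++
  ([seq (a *: p.1, p.2) | p <- s] ++ [seq (b *: p.1, p.2) | p <- s]))).
  by apply: TensCat => //=; rewrite scalerDl; exact: TensAddl.
rewrite -!catA; apply: TensCat; first exact: TensRefl.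
rewrite !catA; apply: TensCat; last exact: TensRefl.
exact: TensCatC.
Qed.

Lemma tscale1 : left_id 1 tscale.
Proof.
move=> x; rewrite -(tens_sumK x) tscale_sum; congr tens_sum.
by elim: (repr x) => [|[v w] s IHs] //=; rewrite scale1r IHs.
Qed.

Lemma tscale0 x : tscale 0 x = tzero.
Proof.
rewrite -(tens_sumK x) tscale_sum; apply/tens_sumP.
elim: (repr x) => [|[v w] s IHs] /=; first exact: TensRefl.
by rewrite scale0r; apply: (@TensCat [:: _] [::]) => //; exact: TensZero.
Qed.

Lemma taddN : left_inverse tzero topp tadd.
Proof. by move=> x; rewrite /topp -[X in tadd _ X]tscale1 -tscaleDl addNr tscale0. Qed.

HB.instance Definition _ := GRing.isZmodule.Build tensor taddA taddC tadd0 taddN.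

Lemma tscaleA a b x : tscale a (tscale b x) = tscale (a * b) x.
Proof.
rewrite -(tens_sumK x) !tscale_sum -map_comp; congr tens_sum.
by apply: eq_map => p /=; rewrite scalerA.
Qed.

Lemma tscaleDr : right_distributive tscale +%R.
Proof.
move=> a x y; rewrite -(tens_sumK x) -(tens_sumK y).
by rewrite [_ + _]tadd_sum !tscale_sum [RHS]tadd_sum map_cat.
Qed.

HB.instance Definition _ :=
  GRing.Zmodule_isLmodule.Build k tensor tscaleA tscale1 tscaleDr tscaleDl.

Lemma tens_sumD s t : tens_sum (s ++ t) = tens_sum s + tens_sum t.
Proof. by rewrite [RHS]tadd_sum. Qed.

Lemma tens_linearl w : linear (tens^~ w).
Proof.
move=> a v v'; rewrite [_ *: tens _ _]tscale_sum [RHS]tadd_sum /=.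
by apply/tens_sumP; exact: TensAddl.
Qed.

Lemma tens_linearr v : linear (tens v).
Proof.
move=> a w w'; rewrite [_ *: tens _ _]tscale_sum [RHS]tadd_sum /=.
apply/tens_sumP; apply: TensTrans (TensAddr _ _ _) _.
apply: (@TensCat [:: _] [:: _] [:: _] [:: _]); last exact: TensRefl.
exact/TensSym/TensScale.
Qed.

Lemma tens0l w : tens 0 w = 0.
Proof. exact/tens_sumP/TensZero. Qed.

Lemma tens0r v : tens v 0 = 0.
Proof.
by have := tens_linearr v (-1) 0 0; rewrite scaler0 addr0 scaleN1r addNr.
Qed.

Lemma tens_suml (I : Type) (r : seq I) (F : I -> V) w :
  tens (\sum_(i <- r) F i) w = \sum_(i <- r) tens (F i) w.
Proof.
have tensDl : {morph tens^~ w : v v' / v + v'}.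
  by move=> v v'; rewrite -[v in LHS]scale1r tens_linearl scale1r.
exact: (big_morph _ tensDl (tens0l w)).
Qed.

Lemma tens_sumE s : tens_sum s = \sum_(p <- s) tens p.1 p.2.
Proof.
elim: s => [|[v w] s IHs]; first by rewrite big_nil.
by rewrite big_cons -IHs -tens_sumD.
Qed.

Fact tlift_key : unit. Proof. by []. Qed.

(* The linear map V (x) W -> U induced by a bilinear map [B]; it is meaningful
   for bilinear [B] only. *)
Definition tlift (U : lmodType k) (B : V -> W -> U) : tensor -> U :=
  locked_with tlift_key (fun x => \sum_(p <- repr x) B p.1 p.2).

Lemma tens_ext (U : lmodType k) (F G : {linear tensor -> U}) :
  (forall v w, F (tens v w) = G (tens v w)) -> F =1 G.
Proof.
move=> FG x; rewrite -(tens_sumK x) tens_sumE !linear_sum.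
by apply: eq_bigr => p _; exact: FG.
Qed.

Section Lift.
Variables (U : lmodType k) (B : V -> W -> U).
Hypothesis Bl : forall w, linear (B^~ w).
Hypothesis Br : forall v, linear (B v).

Lemma bilin0l w : B 0 w = 0.
Proof. by have := Bl w (-1) 0 0; rewrite scaler0 addr0 scaleN1r addNr. Qed.

Lemma bilinZl a v w : B (a *: v) w = a *: B v w.
Proof. by rewrite -[a *: v]addr0 Bl bilin0l addr0. Qed.

Lemma tens_eq_lift s t : tens_eq s t ->
  \sum_(p <- s) B p.1 p.2 = \sum_(p <- t) B p.1 p.2.
Proof.
have B0' v : B v 0 = 0.
  by have := Br v (-1) 0 0; rewrite scaler0 addr0 scaleN1r addNr.
elim=> {s t} [s|s t _|t s u _ -> _ ->|s s' t t' _ IHs _ IHt|s t|v v' w|v w w'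
  |b v w|w] //=.
- by rewrite !big_cat IHs IHt.
- by rewrite !big_cat /= addrC.
- rewrite !big_cons !big_nil /= !addr0.
  by rewrite -[v in LHS]scale1r Bl scale1r.
- rewrite !big_cons !big_nil /= !addr0.
  by rewrite -[w in LHS]scale1r Br scale1r.
- rewrite !big_cons !big_nil /= !addr0.
  by rewrite bilinZl -[_ *: w]addr0 Br B0' addr0.
- by rewrite big_cons big_nil /= bilin0l addr0.
Qed.

Lemma tlift_sum s : tlift B (tens_sum s) = \sum_(p <- s) B p.1 p.2.
Proof. by rewrite /tlift unlock; exact/tens_eq_lift/tens_reprK. Qed.

Lemma tliftE v w : tlift B (tens v w) = B v w.
Proof. by rewrite tlift_sum big_seq1. Qed.

Lemma tlift_linear : linear (tlift B).
Proof.
move=> a x y; rewrite -(tens_sumK x) -(tens_sumK y).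
rewrite [a *: tens_sum _]tscale_sum -tens_sumD !tlift_sum big_cat /=; congr (_ + _).
rewrite big_map scaler_sumr; apply: eq_bigr => p _ /=.
exact: bilinZl.
Qed.

End Lift.
End Tensor.

Section TensorMaps.
Variable k : fieldType.

Section Tmap.
Variables (V V' W W' : lmodType k).
Variables (f : {linear V -> V'}) (g : {linear W -> W'}).

Definition tmap : tensor V W -> tensor V' W' :=
  tlift (fun v w => tens (f v) (g w)).

Lemma tmap_bilinearl w : linear (fun v => tens (f v) (g w)).
Proof. by move=> a v v'; rewrite linearP tens_linearl. Qed.

Lemma tmap_bilinearr v : linear (fun w => tens (f v) (g w)).
Proof. by move=> a w w'; rewrite linearP tens_linearr. Qed.

Lemma tmapE v w : tmap (tens v w) = tens (f v) (g w).
Proof. exact: (tliftE tmap_bilinearl tmap_bilinearr). Qed.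

HB.instance Definition _ := GRing.isLinear.Build k _ _ _ tmap
  (tlift_linear tmap_bilinearl tmap_bilinearr).

End Tmap.

Section Tassoc.
Variables U V W : lmodType k.

Definition tassoc_left (w : W) : tensor U V -> tensor U (tensor V W) :=
  tlift (fun u v => tens u (tens v w)).

Lemma tassoc_left_bilinearl (w : W) (v : V) : linear (fun u : U => tens u (tens v w)).
Proof. exact: tens_linearl. Qed.

Lemma tassoc_left_bilinearr (w : W) (u : U) : linear (fun v : V => tens u (tens v w)).
Proof. by move=> a v v'; rewrite tens_linearl tens_linearr. Qed.

Lemma tassoc_left_sum w s :
  tassoc_left w (tens_sum s) = \sum_(p <- s) tens p.1 (tens p.2 w).
Proof.
exact: (tlift_sum (tassoc_left_bilinearl w) (tassoc_left_bilinearr w)).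
Qed.

Lemma tassoc_leftE w u v : tassoc_left w (tens u v) = tens u (tens v w).
Proof.
exact: (tliftE (tassoc_left_bilinearl w) (tassoc_left_bilinearr w)).
Qed.

Lemma tassoc_left_linear w : linear (tassoc_left w).
Proof.
exact: (tlift_linear (tassoc_left_bilinearl w) (tassoc_left_bilinearr w)).
Qed.

(* The canonical map (U (x) V) (x) W -> U (x) (V (x) W). *)
Definition tassoc : tensor (tensor U V) W -> tensor U (tensor V W) :=
  tlift (fun x w => tassoc_left w x).

Lemma tassoc_bilinearr x : linear (fun w => tassoc_left w x).
Proof.
move=> a w w'; rewrite -(tens_sumK x) !tassoc_left_sum scaler_sumr -big_split.
by apply: eq_bigr => p _; rewrite !tens_linearr.
Qed.

Lemma tassocE u v w : tassoc (tens (tens u v) w) = tens u (tens v w).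
Proof.
exact: etrans (tliftE tassoc_left_linear tassoc_bilinearr _ _)
  (tassoc_leftE _ _ _).
Qed.

HB.instance Definition _ := GRing.isLinear.Build k _ _ _ tassoc
  (tlift_linear tassoc_left_linear tassoc_bilinearr).

End Tassoc.

Section Contract.
Variables (U V : lmodType k) (f : {scalar U}).

Definition contract : tensor U V -> V := tlift (fun u v => f u *: v).

Lemma contract_bilinearl (v : V) : linear (fun u => f u *: v).
Proof. by move=> a u u'; rewrite linearP scalerDl scalerA. Qed.

Lemma contract_bilinearr (u : U) : linear (fun v : V => f u *: v).
Proof. by move=> a v v'; rewrite scalerDr !scalerA mulrC. Qed.

Lemma contractE u v : contract (tens u v) = f u *: v.
Proof. exact: (tliftE contract_bilinearl contract_bilinearr). Qed.

HB.instance Definition _ := GRing.isLinear.Build k _ _ _ contract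
  (tlift_linear contract_bilinearl contract_bilinearr).

End Contract.

Lemma contract_tmap (U V W : lmodType k) (f : {scalar U})
  (g : {linear V -> W}) (x : tensor U V) :
  contract f (tmap idfun g x) = g (contract f x).
Proof.
apply: (tens_ext (F := contract f \o tmap idfun g) (G := g \o contract f)).
by move=> u v /=; rewrite tmapE !contractE linearZ.
Qed.

Lemma contract_tassoc (U V W : lmodType k) (f : {scalar U}) (g : {scalar V})
  (x : tensor U V) (w : W) :
  contract g (contract f (tassoc (tens x w))) = g (contract f x) *: w.
Proof.
rewrite -(tens_sumK x) tens_sumE.
rewrite tens_suml !linear_sum /= scaler_suml; apply: eq_bigr => p _.
by rewrite tassocE !contractE !linearZ /= contractE scalerA.
Qed.

End TensorMaps.

Record coalgebra (k : fieldType) := Coalgebra {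
  coalg_sort :> lmodType k;
  comul : {linear coalg_sort -> tensor coalg_sort coalg_sort};
  counit : {scalar coalg_sort};
  comulA : forall c, tassoc (tmap comul idfun (comul c)) =
                     tmap idfun comul (comul c);
  comul1l : forall c, contract counit (comul c) = c;
  comul1r : forall c, tlift (fun c1 c2 => counit c2 *: c1) (comul c) = c
}.

Section Comodules.
Variables (k : fieldType) (C : coalgebra k).

Record left_comodule := LeftComodule {
  lcomod_sort :> lmodType k;
  lcoact : {linear lcomod_sort -> tensor C lcomod_sort};
  lcoactA : forall m, tassoc (tmap (comul C) idfun (lcoact m)) =
                      tmap idfun lcoact (lcoact m);
  lcoact1 : forall m, contract (counit C) (lcoact m) = m
}.

Record right_comodule := RightComodule {
  rcomod_sort :> lmodType k;
  rcoact : {linear rcomod_sort -> tensor rcomod_sort C};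
  rcoactA : forall m, tassoc (tmap rcoact idfun (rcoact m)) =
                      tmap idfun (comul C) (rcoact m);
  rcoact1 : forall m, tlift (fun m0 c => counit C c *: m0) (rcoact m) = m
}.

Definition lcomodule_hom (M N : left_comodule) (f : {linear M -> N}) : Prop :=
  forall m, lcoact N (f m) = tmap idfun f (lcoact M m).

Definition rcomodule_hom (M N : right_comodule) (f : {linear M -> N}) : Prop :=
  forall m, rcoact N (f m) = tmap f idfun (rcoact M m).

Record lhom (M N : left_comodule) :=
  Lhom { lhom_fun :> {linear M -> N}; lhomP : lcomodule_hom lhom_fun }.

Record rhom (M N : right_comodule) :=
  Rhom { rhom_fun :> {linear M -> N}; rhomP : rcomodule_hom rhom_fun }.

Lemma lhom_ext (M N : left_comodule) (f g : lhom M N) : f =1 g -> f = g.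
Proof.
case: f g => f Hf [g Hg] /= /linear_ext fg; subst g.
by rewrite (Prop_irrelevance Hf Hg).
Qed.

Lemma rhom_ext (M N : right_comodule) (f g : rhom M N) : f =1 g -> f = g.
Proof.
case: f g => f Hf [g Hg] /= /linear_ext fg; subst g.
by rewrite (Prop_irrelevance Hf Hg).
Qed.

Lemma tmap_id (V W : lmodType k) (x : tensor V W) : tmap idfun idfun x = x.
Proof.
by apply: (tens_ext (F := tmap idfun idfun) (G := idfun)) => v w /=; rewrite tmapE.
Qed.

Lemma tmap_comp (V V' V'' W W' W'' : lmodType k)
  (f : {linear V -> V'}) (f' : {linear V' -> V''})
  (g : {linear W -> W'}) (g' : {linear W' -> W''}) (x : tensor V W) :
  tmap f' g' (tmap f g x) = tmap (f' \o f) (g' \o g) x.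
Proof.
apply: (tens_ext (F := tmap f' g' \o tmap f g)
                 (G := tmap (f' \o f) (g' \o g))) => v w /=.
by rewrite !tmapE.
Qed.

Lemma tmap0r (V V' W W' : lmodType k) (f : {linear V -> V'}) (x : tensor V W) :
  tmap f (\0 : {linear W -> W'}) x = 0.
Proof.
apply: (tens_ext (F := tmap f (\0 : {linear W -> W'})) (G := \0)) => v w.
by rewrite /= tmapE tens0r.
Qed.

Lemma tmap0l (V V' W W' : lmodType k) (g : {linear W -> W'}) (x : tensor V W) :
  tmap (\0 : {linear V -> V'}) g x = 0.
Proof.
apply: (tens_ext (F := tmap (\0 : {linear V -> V'}) g) (G := \0)) => v w.
by rewrite /= tmapE tens0l.
Qed.

Definition lhom_id (M : left_comodule) : lhom M M.
Proof. by exists idfun => m; rewrite tmap_id. Defined.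

Definition rhom_id (M : right_comodule) : rhom M M.
Proof. by exists idfun => m; rewrite tmap_id. Defined.

Definition lhom_comp (L M N : left_comodule) (g : lhom M N) (f : lhom L M) :
  lhom L N.
Proof.
by exists (g \o f) => m /=; rewrite !lhomP tmap_comp.
Defined.

Definition rhom_comp (L M N : right_comodule) (g : rhom M N) (f : rhom L M) :
  rhom L N.
Proof.
by exists (g \o f) => m /=; rewrite !rhomP tmap_comp.
Defined.

Definition lhom_zero (M N : left_comodule) : lhom M N.
Proof. by exists \0 => m /=; rewrite tmap0r linear0. Defined.

Definition rhom_zero (M N : right_comodule) : rhom M N.
Proof. by exists \0 => m /=; rewrite tmap0l linear0. Defined.

Definition left_comodule_category : category.
Proof.
refine (@Category left_comodule lhom lhom_id lhom_comp lhom_zero _ _ _ _ _).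
- by move=> *; apply: lhom_ext.
- by move=> *; apply: lhom_ext.
- by move=> *; apply: lhom_ext.
- by move=> *; apply: lhom_ext.
- by move=> L M N g; apply: lhom_ext => x /=; exact: linear0.
Defined.

Definition right_comodule_category : category.
Proof.
refine (@Category right_comodule rhom rhom_id rhom_comp rhom_zero _ _ _ _ _).
- by move=> *; apply: rhom_ext.
- by move=> *; apply: rhom_ext.
- by move=> *; apply: rhom_ext.
- by move=> *; apply: rhom_ext.
- by move=> L M N g; apply: rhom_ext => x /=; exact: linear0.
Defined.

Definition right_semiperfect : Prop :=
  enough_projectives right_comodule_category.

End Comodules.

Section DualAlgebra.
Variables (k : fieldType) (C : coalgebra k).

Definition dual_algebra : Type := {scalar C}.

HB.instance Definition _ := gen_eqMixin dual_algebra.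
HB.instance Definition _ := gen_choiceMixin dual_algebra.

Implicit Types f g h : dual_algebra.

Lemma dual_ext f g : (f : {scalar C}) =1 (g : {scalar C}) -> f = g.
Proof. exact: linear_ext. Qed.

Definition dual_zero : dual_algebra := (\0 : {scalar C}).
Definition dual_opp f : dual_algebra := (\- (f : {scalar C}) : {scalar C}).
Definition dual_add f g : dual_algebra :=
  ((f : {scalar C}) \+ (g : {scalar C}) : {scalar C}).

Lemma dual_addA : associative dual_add.
Proof. by move=> f g h; apply: dual_ext => c /=; rewrite addrA. Qed.

Lemma dual_addC : commutative dual_add.
Proof. by move=> f g; apply: dual_ext => c /=; rewrite addrC. Qed.

Lemma dual_add0 : left_id dual_zero dual_add.
Proof. by move=> f; apply: dual_ext => c /=; rewrite add0r. Qed.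

Lemma dual_addN : left_inverse dual_zero dual_opp dual_add.
Proof. by move=> f; apply: dual_ext => c /=; rewrite addNr. Qed.

HB.instance Definition _ := GRing.isZmodule.Build dual_algebra
  dual_addA dual_addC dual_add0 dual_addN.

Section Convolution.
Variables f g : {scalar C}.

Definition conv (c : C) : k :=
  tlift (fun c1 c2 => f c1 * g c2 : k^o) (comul C c).

Lemma conv_bilinearl c2 : linear (fun c1 => f c1 * g c2 : k^o).
Proof. by move=> a c c'; rewrite linearP mulrDl -mulrA. Qed.

Lemma conv_bilinearr c1 : linear (fun c2 => f c1 * g c2 : k^o).
Proof. by move=> a c c'; rewrite linearP mulrDr mulrCA. Qed.

Lemma conv_linear : scalar conv.
Proof.
move=> a c c'; rewrite /conv linearP.
exact: (tlift_linear conv_bilinearl conv_bilinearr).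
Qed.

HB.instance Definition _ := GRing.isLinear.Build k C k *%R conv conv_linear.

Lemma convE c : conv c = g (contract f (comul C c)).
Proof.
rewrite /conv -(tens_sumK (comul C c)).
rewrite (tlift_sum conv_bilinearl conv_bilinearr) tens_sumE !linear_sum /=.
by apply: eq_bigr => p _; rewrite contractE linearZ.
Qed.

End Convolution.

Definition dual_one : dual_algebra := counit C.
Definition dual_mul f g : dual_algebra := (conv f g : {scalar C}).

Lemma dual_mulE f g c : (dual_mul f g : {scalar C}) c =
  (g : {scalar C}) (contract (f : {scalar C}) (comul C c)).
Proof. exact: convE. Qed.

Lemma contract_conv (M : left_comodule C) f g (m : M) :
  contract (dual_mul f g) (lcoact M m) =
  contract g (lcoact M (contract f (lcoact M m))).
Proof.
rewrite -contract_tmap -lcoactA -{1 2}(tens_sumK (lcoact M m)) tens_sumE.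
rewrite !linear_sum /=; apply: eq_bigr => p _.
by rewrite tmapE contractE contract_tassoc dual_mulE.
Qed.

Definition coalg_left_comodule : left_comodule C :=
  LeftComodule (@comulA k C) (@comul1l k C).

Lemma dual_mulA : associative dual_mul.
Proof.
move=> f g h; apply: dual_ext => c; rewrite !dual_mulE.
by rewrite (@contract_conv coalg_left_comodule).
Qed.

Lemma dual_mul1l : left_id dual_one dual_mul.
Proof. by move=> f; apply: dual_ext => c; rewrite dual_mulE comul1l. Qed.

Lemma dual_mul1r : right_id dual_one dual_mul.
Proof.
move=> f; apply: dual_ext => c; rewrite -[in RHS](comul1r c).
have Bl c2 : linear (fun c1 : C => counit C c2 *: c1).
  exact: contract_bilinearr.
have Br (c1 : C) : linear (fun c2 : C => counit C c2 *: c1).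
  exact: contract_bilinearl.
rewrite /= /conv -(tens_sumK (comul C c)) !tlift_sum //.
- rewrite linear_sum; apply: eq_bigr => p _.
  by rewrite linearZ /= mulrC.
- exact: conv_bilinearl.
- exact: conv_bilinearr.
Qed.

Lemma dual_mulDl : left_distributive dual_mul +%R.
Proof.
move=> f g h; apply: dual_ext => c /=.
rewrite /conv -(tens_sumK (comul C c)) !tlift_sum;
  try exact: conv_bilinearl; try exact: conv_bilinearr.
by rewrite -big_split; apply: eq_bigr => p _; exact: mulrDl.
Qed.

Lemma dual_mulDr : right_distributive dual_mul +%R.
Proof. by move=> f g h; apply: dual_ext => c /=; rewrite !convE. Qed.

HB.instance Definition _ := GRing.Zmodule_isPzRing.Build dual_algebra
  dual_mulA dual_mul1l dual_mul1r dual_mulDl dual_mulDr.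

End DualAlgebra.

Section Inclusion.
Variables (k : fieldType) (C : coalgebra k).

(* The comodule [M] as a right C^*-module, m . f = sum f(m_(-1)) m_(0). *)
Definition rational_module (M : left_comodule C) : Type := M.

Section Action.
Variable M : left_comodule C.

HB.instance Definition _ := GRing.Zmodule.on (rational_module M).

Definition dual_act (f : (dual_algebra C)^c) (m : rational_module M) : rational_module M :=
  contract (f : {scalar C}) (lcoact M m).

Lemma dual_actA f g m : dual_act f (dual_act g m) = dual_act (f * g) m.
Proof. by rewrite /dual_act -contract_conv. Qed.

Lemma dual_act1 : left_id 1 dual_act.
Proof. by move=> m; exact: lcoact1. Qed.

Lemma dual_actDr : right_distributive dual_act +%R.
Proof.
move=> f m m'; rewrite /dual_act.
by rewrite [lcoact M _](linearD (lcoact M)) linearD.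
Qed.

Lemma dual_actDl m : {morph dual_act^~ m : f g / f + g}.
Proof.
move=> f g; rewrite /dual_act -(tens_sumK (lcoact M _)) tens_sumE.
rewrite !linear_sum -big_split; apply: eq_bigr => p _ /=.
by rewrite !contractE -scalerDl.
Qed.

HB.instance Definition _ := GRing.Zmodule_isLmodule.Build
  (dual_algebra C)^c (rational_module M) dual_actA dual_act1 dual_actDr dual_actDl.

End Action.

Section Morphism.
Variables (M N : left_comodule C) (f : lhom M N).

Definition rational_map (m : rational_module M) : rational_module N := f m.

Lemma rational_map_linear : linear rational_map.
Proof.
move=> a m m'; rewrite /rational_map [LHS]linearD; congr (_ + _).
by rewrite -[LHS]contract_tmap -lhomP.
Qed.

HB.instance Definition _ := GRing.isLinear.Build
  (dual_algebra C)^c (rational_module M) (rational_module N) *:%R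
  rational_map rational_map_linear.

End Morphism.

Definition inclusion :
  functor (left_comodule_category C) (right_module_category (dual_algebra C)).
Proof.
refine (@Functor (left_comodule_category C)
  (right_module_category (dual_algebra C))
  (fun M => rational_module M : lmodType (dual_algebra C)^c)
  (fun M N f => (rational_map f : {linear rational_module M -> rational_module N})) _ _).
- by move=> M; apply: linear_ext.
- by move=> L M N g f; apply: linear_ext.
Defined.

End Inclusion.

(* Main.v *)
(* The inclusion of comodules into modules is fully faithful, and its image is
   closed, up to isomorphism, under quotients and submodules: an element of
   C (x) V is determined by its contractions with all functionals on C, so that
   C^*-submodules of a comodule are subcomodules.  Such an embedding preserves
   and reflects epimorphisms, cokernels and superfluous epimorphisms, and every
   object occurring in the definition of dual CS-Rickart is, on the module side,
   a quotient of i(N).  Superfluity can be tested on subobjects, which are again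
   comodules. *)
From HB Require Import structures.
From mathcomp Require Import all_boot all_algebra.
From mathcomp Require Import boolp classical_sets.
Require Import Defs.

Set Implicit Arguments.
Unset Strict Implicit.
Unset Printing Implicit Defensive.

Import GRing.Theory.
Local Open Scope ring_scope.
Local Open Scope quotient_scope.

(** * Submodules and quotients of modules over a ring *)

Section Submodules.
Variables (R : pzRingType) (V : lmodType R).

Definition submodule (H : V -> Prop) : Prop :=
  H 0 /\ forall a u v, H u -> H v -> H (a *: u + v).

Variable H : V -> Prop.

(** The proof is an argument so that the closure instance below can be found from the predicate
    alone. *)
Definition submodule_mem (_ : submodule H) : pred V := fun v => `[< H v >].

Hypothesis submodH : submodule H.
Local Notation S := (submodule_mem submodH).

Lemma submodule_mem_closed : GRing.subsemimod_closed S.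
Proof.
case: (submodH) => H0 HL; split; first split.
- exact/asboolP.
- move=> u v /asboolP Hu /asboolP Hv; apply/asboolP.
  by rewrite -[u]scale1r; exact: HL.
- move=> a u /asboolP Hu; apply/asboolP.
  by rewrite -[_ *: _]addr0; exact: HL.
Qed.

HB.instance Definition _ :=
  GRing.isSubmodClosed.Build R V S submodule_mem_closed.

Definition subobject : Type := {v : V | S v}.

HB.instance Definition _ := SubChoice.on subobject.
HB.instance Definition _ := [SubChoice_isSubLmodule of subobject by <:].

Let subgroupH : zmodClosed V := GRing.ZmodClosed.clone V S _.

Definition quotient : Type := Quotient.quot subgroupH.

HB.instance Definition _ := GRing.Zmodule.on quotient.

Definition quotient_proj (v : V) : quotient := \pi_(Quotient.quot subgroupH) v.

Lemma quotient_proj_eq u v :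
  quotient_proj u = quotient_proj v <-> H (u - v).
Proof.
split.
  by move/eqP; rewrite -Quotient.idealrBE => /asboolP.
by move=> Huv; apply/eqP; rewrite -Quotient.idealrBE; exact/asboolP.
Qed.

Lemma quotient_proj_surj (x : quotient) : exists v, quotient_proj v = x.
Proof. by exists (repr x); exact: reprK. Qed.

Lemma quotient_projD : {morph quotient_proj : u v / u + v}.
Proof. exact: Quotient.pi_add. Qed.

Definition quotient_scale (a : R) (x : quotient) : quotient :=
  quotient_proj (a *: repr x).

(** Two representatives of a class differ by an element of [H], which is closed under scaling; so
    [quotient_scale] is well defined. *)
Lemma quotient_projZ a v :
  quotient_scale a (quotient_proj v) = quotient_proj (a *: v).
Proof.
apply/quotient_proj_eq; rewrite -scalerBr -[_ *: _]addr0.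
case: (submodH) => H0 HL; apply: (HL) => //.
by apply/quotient_proj_eq; exact: reprK.
Qed.

Lemma quotient_scaleA a b x :
  quotient_scale a (quotient_scale b x) = quotient_scale (a * b) x.
Proof.
by have [v <-] := quotient_proj_surj x; rewrite !quotient_projZ scalerA.
Qed.

Lemma quotient_scale1 : left_id 1 quotient_scale.
Proof.
by move=> x; have [v <-] := quotient_proj_surj x; rewrite quotient_projZ scale1r.
Qed.

Lemma quotient_scaleDr : right_distributive quotient_scale +%R.
Proof.
move=> a x y; have [u <-] := quotient_proj_surj x.
have [v <-] := quotient_proj_surj y.
by rewrite -quotient_projD !quotient_projZ -quotient_projD scalerDr.
Qed.

Lemma quotient_scaleDl x : {morph quotient_scale^~ x : a b / a + b}.
Proof.
move=> a b; have [u <-] := quotient_proj_surj x.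
by rewrite !quotient_projZ -quotient_projD scalerDl.
Qed.

HB.instance Definition _ := GRing.Zmodule_isLmodule.Build R quotient
  quotient_scaleA quotient_scale1 quotient_scaleDr quotient_scaleDl.

Lemma quotient_proj_linear : linear quotient_proj.
Proof.
by move=> a u v; rewrite quotient_projD -quotient_projZ.
Qed.

HB.instance Definition _ := GRing.isLinear.Build R V quotient *:%R
  quotient_proj quotient_proj_linear.

End Submodules.

Lemma submodule_image (R : pzRingType) (U V : lmodType R)
  (f : {linear U -> V}) : submodule (fun v => exists u, f u = v).
Proof.
split; first by exists 0; exact: linear0.
by move=> a _ _ [u <-] [v <-]; exists (a *: u + v); rewrite linearP.
Qed.

Section Factor.
Variables (R : pzRingType) (U V W : lmodType R).
Variables (p : {linear U -> V}) (g : {linear U -> W}).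
Hypotheses (p_surj : forall v, exists u, p u = v).
Hypothesis ker_pg : forall u, p u = 0 -> g u = 0.

(** With a set-theoretic section [s] of [p], the map [g \o s] works: the kernel condition gives
    [g (s (p u)) = g u], which also makes it linear although [s] need not be. *)
Lemma factor_surj : exists h : {linear V -> W}, forall u, h (p u) = g u.
Proof.
pose s v := projT1 (cid (p_surj v)).
have ps v : p (s v) = v by rewrite /s; case: cid.
have gs u : g (s (p u)) = g u.
  by apply/eqP; rewrite -subr_eq0 -linearB; apply/eqP/ker_pg; rewrite linearB ps subrr.
pose h v := g (s v).
have h_lin : linear h.
  move=> a v v'; rewrite -[v in LHS]ps -[v' in LHS]ps -linearP /h.
  by rewrite gs linearP.
pose hL : {linear V -> W} := HB.pack h (GRing.isLinear.Build R V W *:%R h h_lin).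
by exists hL.
Qed.

End Factor.

(** * Separating a vector from a subspace by a functional *)

Section Functional.
Variables (k : fieldType) (V : lmodType k) (W : set V) (c : V).
Hypotheses (submodW : submodule W) (Wc : ~ W c).

(* Zorn yields a submodule maximal among those that contain [W] and avoid [c];
   it is a hyperplane supplementary to the line of [c]. *)
Lemma exists_functional :
  exists f : {scalar V}, f c = 1 /\ forall w, W w -> f w = 0.
Proof.
(* Joining [W] to [A] lets the empty chain through: its union is empty, and [W] itself satisfies the
   condition. *)
pose P (A : set V) := submodule (W `|` A)%classic /\ ~ (W `|` A)%classic c.
have [|A [[subA nAc] maxA]] := @Zorn_bigcup V P.
  move=> F FP totF; split; last first.
    move=> [/Wc//|[X FX Xc]]; have [_ nXc] := FP _ FX.
    by apply: nXc; right.
  have W0 : W 0 by case: submodW.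
  split; first by left.
  have sub2 X Y : F X -> F Y -> 
      exists2 Z, F Z & (X `<=` Z)%classic /\ (Y `<=` Z)%classic.
    by move=> FX FY; case: (totF _ _ FX FY) => XY;
      [exists Y|exists X] => //; split.
  have combZ Z a u v : F Z -> (W `|` Z)%classic u -> (W `|` Z)%classic v ->
      (W `|` \bigcup_(X in F) X)%classic (a *: u + v).
    move=> FZ Zu Zv; have [[_ ZL] _] := FP _ FZ.
    by case: (ZL a _ _ Zu Zv) => ?; [left|right; exists Z].
  move=> a u v [Wu|[X FX Xu]] [Wv|[Y FY Yv]].
  - by left; case: submodW => _; exact.
  - by apply: (combZ Y) => //; [left|right].
  - by apply: (combZ X) => //; [right|left].
  - have [Z FZ [XZ YZ]] := sub2 X Y FX FY.
    by apply: (combZ Z) => //; right; [exact: XZ|exact: YZ].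
pose H := (W `|` A)%classic.
have [H0 HL] := subA.
have HN v a : a != 0 -> H (a *: v) -> H v.
  move=> a0 Hv; rewrite -[v]scale1r -(mulVf a0) -scalerA -[_ *: _]addr0.
  exact: HL.
(* Otherwise [B], the sum of [H] and the line of [v], is strictly larger and still avoids [c]: if
   [c - a *: v] were in [H], then either [a = 0] and [c] is in [H], or [v - a^-1 *: c] is in [H]. *)
have split_c v : exists a, H (v - a *: c).
  apply: contrapT => /forallNP nH.
  pose B : set V := fun u => exists a, H (u - a *: v).
  have HB u : H u -> B u by exists 0; rewrite scale0r subr0.
  have WB : (W `|` B)%classic = B.
    by apply/seteqP; split=> u; [case=> // Wu; apply: HB; left|right].
  apply: (maxA B).
    split; first by move=> u Au; apply: HB; right.
    move=> BA; apply: (nH 0); rewrite scale0r subr0; right; apply: BA.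
    by exists 1; rewrite scale1r subrr.
  split; rewrite WB.
    split; first by apply: HB.
    move=> a u u' [b Hu] [b' Hu']; exists (a * b + b').
    rewrite scalerDl -scalerA opprD addrACA -scalerBr; exact: HL.
  case=> a Hca; have [a0|a0] := eqVneq a 0.
    by apply: nAc; move: Hca; rewrite a0 scale0r subr0.
  apply: (nH a^-1); apply: (HN _ (- a)); first by rewrite oppr_eq0.
  by rewrite scalerBr scalerA mulNr mulfV // scaleN1r opprK scaleNr addrC.
pose phi v := projT1 (cid (split_c v)).
have phiH v : H (v - phi v *: c) by rewrite /phi; case: cid.
(* Two distinct coefficients would put a nonzero multiple of [c] in [H]. *)
have phiE v a : H (v - a *: c) -> phi v = a.
  move=> Hva; apply/eqP; rewrite -subr_eq0; apply: contrapT => /negP ne.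
  apply: nAc; apply: (HN _ _ ne).
  have -> : (phi v - a) *: c = -1 *: (v - phi v *: c) + (v - a *: c); last first.
    exact: HL (phiH v) Hva.
  by rewrite scaleN1r opprB addrA subrK scalerBl.
have phi_lin : scalar phi.
  move=> a u v; apply: phiE.
  by rewrite scalerDl -scalerA opprD addrACA -scalerBr; exact: HL (phiH u) (phiH v).
pose f : {scalar V} :=
  HB.pack phi (GRing.isLinear.Build k V k *%R phi phi_lin).
exists f; split.
  by apply: phiE; rewrite scale1r subrr.
by move=> w Ww; apply: phiE; rewrite scale0r subr0; left.
Qed.

End Functional.

(** * Tensors are determined by their contractions *)

Section Contraction.
Variables (k : fieldType) (C : lmodType k).

(* An expression of [x] of minimal length has linearly independent left
   factors, which functionals can then separate. *)
Lemma tensor_decomp (V : lmodType k) (x : tensor C V) :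
  exists s : seq (C * V), x = tens_sum s /\
    forall p, p \in s -> exists f : {scalar C}, contract f x = p.2.
Proof.
have tensDr (c : C) (v v' : V) : tens c (v + v') = tens c v + tens c v'.
  by rewrite -[v in LHS]scale1r tens_linearr scale1r.
have tensZ (c : C) a (v : V) : tens (a *: c) v = tens c (a *: v).
  by apply/tens_sumP; exact: TensScale.
suff main n : forall (c : 'I_n -> C) (v : 'I_n -> V),
    x = \sum_i tens (c i) (v i) -> exists s : seq (C * V), x = tens_sum s /\
    forall p, p \in s -> exists f : {scalar C}, contract f x = p.2.
  pose s := repr x.
  apply: (main (size s) (fun i => (tnth (in_tuple s) i).1)
    (fun i => (tnth (in_tuple s) i).2)).
  rewrite -[LHS](tens_sumK x) tens_sumE.
  by rewrite [LHS]big_tnth.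
elim: n => [|n IHn] c v xE.
  by exists [::]; split=> //; rewrite xE big_ord0 tens_sumE big_nil.
pose span (i : 'I_n.+1) : set C :=
  fun u => exists a : 'I_n -> k, u = \sum_j a j *: c (lift i j).
(* If [c i] is a combination of the other left factors, expanding it shortens the sum, [v i] being
   absorbed into the other right factors. Otherwise a functional that is 1 at [c i] and 0 on the
   other left factors contracts [x] to [v i]. *)
have [[i [a ci]]|/forallNP ind] := pselect (exists i, span i (c i)).
  apply: (IHn (c \o lift i) (fun j => v (lift i j) + a j *: v i)).
  rewrite xE (bigD1_ord i) //= ci tens_suml -big_split; apply: eq_bigr => j _ /=.
  by rewrite tensZ addrC -tensDr.
exists [seq (c i, v i) | i <- enum 'I_n.+1]; split.
  by rewrite xE tens_sumE big_map big_enum.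
move=> _ /mapP[i _ ->] /=.
have span_sub : submodule (span i).
  split; first by exists (fun=> 0); rewrite big1 // => j _; rewrite scale0r.
  move=> b _ _ [a1 ->] [a2 ->]; exists (fun j => b * a1 j + a2 j).
  by rewrite scaler_sumr -big_split; apply: eq_bigr => j _; rewrite scalerDl scalerA.
have [f [fi f0]] := exists_functional span_sub (ind i).
exists f; rewrite xE linear_sum /= (bigD1_ord i) //= contractE fi scale1r.
rewrite big1 ?addr0 // => j _; rewrite contractE f0 ?scale0r //.
exists (fun l => (l == j)%:R); rewrite (bigD1 j) //= eqxx scale1r big1 ?addr0 //.
by move=> l /negbTE ->; rewrite scale0r.
Qed.

(** The right factors of the decomposition are contractions of [x], hence all vanish. *)
Lemma contract_eq0 (V : lmodType k) (x : tensor C V) :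
  (forall f : {scalar C}, contract f x = 0) -> x = 0.
Proof.
have [s [xE sf]] := tensor_decomp x => x0; rewrite xE tens_sumE big_seq big1 //.
by move=> p /sf[f]; rewrite x0 => <-; rewrite tens0r.
Qed.

Lemma contract_inj (V : lmodType k) (x y : tensor C V) :
  (forall f : {scalar C}, contract f x = contract f y) -> x = y.
Proof.
move=> xy; apply/eqP; rewrite -subr_eq0; apply/eqP/contract_eq0 => f.
by rewrite linearB /= xy subrr.
Qed.

(** Flatness of [C] over [k], obtained here because contractions commute with [tmap idfun g] and
    separate tensors. *)
Lemma tmap_inj (U V : lmodType k) (g : {linear U -> V}) :
  injective g -> injective (tmap (idfun : {linear C -> C}) g).
Proof.
move=> g_inj x y xy; apply: contract_inj => f; apply: g_inj.
by rewrite -!contract_tmap xy.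
Qed.

(** The right factors of the decomposition are contractions of [x], so each can be lifted along [g].
    This is what restricts a coaction to a submodule. *)
Lemma tmap_im (U V : lmodType k) (g : {linear U -> V}) (x : tensor C V) :
  (forall f : {scalar C}, exists u, g u = contract f x) ->
  exists y, tmap (idfun : {linear C -> C}) g y = x.
Proof.
have [s [xE sf]] := tensor_decomp x => xg.
have sg p : p \in s -> exists u, g u = p.2.
  by move=> /sf[f <-]; exact: xg.
rewrite xE tens_sumE; elim: s sg {xE sf} => [|p s IHs] sg.
  by exists 0; rewrite linear0 big_nil.
have [u gu] := sg p (mem_head _ _).
have [|y yE] := IHs; first by move=> q qs; apply: sg; rewrite inE qs orbT.
by exists (tens p.1 u + y); rewrite linearD /= yE tmapE gu big_cons.
Qed.

End Contraction.

(** * Epimorphisms and cokernels in a category with zero morphisms *)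

Section Cokernels.
Variable A : category.

Lemma epi_comp (X Y Z : A) (g : Hom Y Z) (f : Hom X Y) :
  epi g -> epi f -> epi (g \oc f).
Proof.
move=> eg ef W a b; rewrite !comp_assoc => ab.
exact/eg/ef.
Qed.

Lemma epi_compl (X Y Z : A) (g : Hom Y Z) (f : Hom X Y) :
  epi (g \oc f) -> epi g.
Proof. by move=> egf W a b ab; apply: egf; rewrite !comp_assoc ab. Qed.

Lemma section_epi (X Y : A) (r : Hom X Y) (s : Hom Y X) :
  r \oc s = idm Y -> epi r.
Proof.
by move=> rs W a b ab; rewrite -[a]comp_idr -[b]comp_idr -rs !comp_assoc ab.
Qed.

Lemma cokernel_epi (X Y Q : A) (f : Hom X Y) (q : Hom Y Q) :
  is_cokernel f q -> epi q.
Proof.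
move=> [qf qU] W a b ab.
have [|u [_ uU]] := qU W (a \oc q); first by rewrite -comp_assoc qf comp_zeror.
by rewrite -(uU a) // (uU b).
Qed.

Lemma cokernel_iso (X Y Q Q' : A) (f : Hom X Y) (q : Hom Y Q)
    (u : Hom Q Q') (v : Hom Q' Q) :
  v \oc u = idm Q -> u \oc v = idm Q' -> is_cokernel f q ->
  is_cokernel f (u \oc q).
Proof.
move=> vu uv [qf qU]; split; first by rewrite -comp_assoc qf comp_zeror.
move=> W g gf; have [w [wq wU]] := qU W g gf.
exists (w \oc v); split.
  by rewrite -comp_assoc (comp_assoc v) vu comp_idl.
move=> w' w'uq; rewrite (wU (w' \oc u)) -?comp_assoc //.
by rewrite uv comp_idr.
Qed.

Lemma cokernel_unique (X Y Q Q' : A) (f : Hom X Y)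
    (q : Hom Y Q) (q' : Hom Y Q') :
  is_cokernel f q -> is_cokernel f q' ->
  exists (u : Hom Q Q') (v : Hom Q' Q),
    [/\ v \oc u = idm Q, u \oc v = idm Q' & u \oc q = q'].
Proof.
move=> cq cq'; case: (cq) => qf /(_ _ q' cq'.1)[u [uq _]].
case: (cq') => _ /(_ _ q qf)[v [vq _]].
exists u, v; split=> //.
  by apply: (cokernel_epi cq); rewrite -comp_assoc uq vq comp_idl.
by apply: (cokernel_epi cq'); rewrite -comp_assoc vq uq comp_idl.
Qed.

End Cokernels.

(** * Transfer along a fully faithful functor whose image is closed under quotients and contains
    images *)

Section Transfer.
Variables (A B : category) (F : functor A B).
Hypothesis F_full : forall (X Y : A) (g : Hom (F X) (F Y)),
  exists f : Hom X Y, Fmap F f = g.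
Hypothesis F_faithful : forall (X Y : A) (f g : Hom X Y),
  Fmap F f = Fmap F g -> f = g.
Hypothesis F_zero : forall X Y : A, Fmap F (zerom X Y) = zerom (F X) (F Y).
Hypothesis B_cokernel : forall (X Y : B) (f : Hom X Y),
  exists (Q : B) (q : Hom Y Q), is_cokernel f q.
Hypothesis B_epi : forall (X Y Q : B) (f : Hom X Y),
  is_cokernel f (zerom Y Q) -> epi f.
Hypothesis F_quotient : forall (X : A) (Y : B) (e : Hom (F X) Y), epi e ->
  exists (X' : A) (p : Hom X X') (u : Hom (F X') Y) (v : Hom Y (F X')),
    [/\ v \oc u = idm (F X'), u \oc v = idm Y & u \oc Fmap F p = e].
Hypothesis F_image : forall (X : B) (Y : A) (h : Hom X (F Y)),
  exists (S : A) (j : Hom S Y) (e : Hom X (F S)),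
    epi e /\ Fmap F j \oc e = h.

Lemma reflects_epi (X Y : A) (f : Hom X Y) : epi (Fmap F f) -> epi f.
Proof.
by move=> eFf Z g h gh; apply/F_faithful/eFf; rewrite -!Fmap_comp gh.
Qed.

(** Fullness lifts the induced morphism, faithfulness its equations and its uniqueness. *)
Lemma reflects_cokernel (X Y Q : A) (f : Hom X Y) (q : Hom Y Q) :
  is_cokernel (Fmap F f) (Fmap F q) -> is_cokernel f q.
Proof.
move=> [qf qU]; split; first by apply: F_faithful; rewrite Fmap_comp F_zero.
move=> Z g gf; have [|w [wq wU]] := qU _ (Fmap F g).
  by rewrite -Fmap_comp gf F_zero.
have [u uw] := F_full w; exists u; split.
  by apply: F_faithful; rewrite Fmap_comp uw.
move=> u' u'q; apply: F_faithful; rewrite uw; apply: wU.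
by rewrite -Fmap_comp u'q.
Qed.

(** The cokernel in [B] is an epimorphism out of [F Y], so up to isomorphism it lies in the image of
    [F]. *)
Lemma cokernel_lift (X Y : A) (f : Hom X Y) :
  exists (Q : A) (q : Hom Y Q), is_cokernel (Fmap F f) (Fmap F q).
Proof.
have [Q [q cq]] := B_cokernel (Fmap F f).
have [Q' [p [u [v [vu uv up]]]]] := F_quotient (cokernel_epi cq).
exists Q', p; suff -> : Fmap F p = v \oc q by exact: cokernel_iso uv vu cq.
by rewrite -up comp_assoc vu comp_idl.
Qed.

Lemma preserves_cokernel (X Y Q : A) (f : Hom X Y) (q : Hom Y Q) :
  is_cokernel f q -> is_cokernel (Fmap F f) (Fmap F q).
Proof.
move=> cq; have [Q' [q' Fcq']] := cokernel_lift f.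
have [u [v [vu uv <-]]] := cokernel_unique (reflects_cokernel Fcq') cq.
rewrite Fmap_comp; apply: (@cokernel_iso _ _ _ _ _ _ _ _ (Fmap F v)) => //.
  by rewrite -Fmap_comp vu Fmap_id.
by rewrite -Fmap_comp uv Fmap_id.
Qed.

(** The lifted cokernel [q] kills the epimorphism [f], hence is zero, and in [B] a zero cokernel
    forces an epimorphism. *)
Lemma preserves_epi (X Y : A) (f : Hom X Y) : epi f -> epi (Fmap F f).
Proof.
move=> ef; have [Q [q Fcq]] := cokernel_lift f.
have [qf _] := reflects_cokernel Fcq.
have q0 : q = zerom Y Q by apply: ef; rewrite qf comp_zerol.
by apply: (@B_epi _ _ (F Q)); rewrite -F_zero -q0.
Qed.

Lemma preserves_superfluous (X Y : A) (t : Hom X Y) :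
  superfluous t -> superfluous (Fmap F t).
Proof.
move=> [et st]; split; first exact: preserves_epi.
(* The test morphism [h] may start outside the image of [F]; its factor [j] comes from [A], where
   superfluity of [t] applies to it. *)
move=> P h eth; have [S [j [e [ee jeh]]]] := F_image h.
rewrite -jeh in eth *; apply: epi_comp => //.
apply/preserves_epi/st/reflects_epi; apply: (@epi_compl _ _ _ _ _ e).
by rewrite Fmap_comp -comp_assoc.
Qed.

Lemma reflects_superfluous (X Y : A) (t : Hom X Y) :
  superfluous (Fmap F t) -> superfluous t.
Proof.
move=> [et st]; split; first exact: reflects_epi.
move=> P h eth; apply/reflects_epi/st; rewrite -Fmap_comp.
exact: preserves_epi.
Qed.

Lemma superfluous_iso (X X' Y Y' : B) (t : Hom X Y)
    (u : Hom X' X) (u' : Hom X X') (w : Hom Y Y') (w' : Hom Y' Y) :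
  u \oc u' = idm X -> u' \oc u = idm X' -> w \oc w' = idm Y' ->
  w' \oc w = idm Y -> superfluous t -> superfluous (w \oc t \oc u).
Proof.
move=> uu' u'u ww' w'w [et st]; split.
  apply: epi_comp (section_epi uu'); exact: epi_comp (section_epi ww') et.
move=> P h eh.
have {}eh : epi (u \oc h).
  apply: st; have := epi_comp (section_epi w'w) eh.
  by rewrite !comp_assoc w'w comp_idl.
have := epi_comp (section_epi u'u) eh.
by rewrite comp_assoc u'u comp_idl.
Qed.

Theorem dual_CS_Rickart_transfer (M N : A) :
  dual_CS_Rickart M N <-> dual_CS_Rickart (F M) (F N).
Proof.
split=> MN f.
  have [f' <-] := F_full f.
  have [Q [q [cq [P [r [t [[s rs] st qtr]]]]]]] := MN f'.
  exists (F Q), (Fmap F q); split; first exact: preserves_cokernel.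
  exists (F P), (Fmap F r), (Fmap F t); split.
  - by exists (Fmap F s); rewrite -Fmap_comp rs Fmap_id.
  - exact: preserves_superfluous.
  - by rewrite -Fmap_comp qtr.
have [Q [q [cq [P [r [t [[s rs] st qtr]]]]]]] := MN (Fmap F f).
have [Q' [q' cq']] := cokernel_lift f.
have [w [w' [w'w ww' wq]]] := cokernel_unique cq cq'.
(* The retraction [r] is an epimorphism out of [F N], so [P] is isomorphic to some [F P']. The data
   on [P] and [Q] are moved along the isomorphisms to [F P'] and [F Q'], then lifted by fullness. *)
have [P' [p [u [v [vu uv up]]]]] := F_quotient (section_epi rs).
have [t' t'E] := F_full (w \oc t \oc u).
have [s' s'E] := F_full (s \oc u).
exists Q', q'; split; first exact: reflects_cokernel.
exists P', p, t'; split.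
- exists s'; apply: F_faithful; rewrite Fmap_comp Fmap_id s'E.
  have -> : Fmap F p = v \oc r by rewrite -up comp_assoc vu comp_idl.
  by rewrite -comp_assoc (comp_assoc r) rs comp_idl.
- by apply: reflects_superfluous; rewrite t'E; exact: superfluous_iso uv vu ww' w'w st.
- apply: F_faithful; rewrite Fmap_comp t'E -wq qtr -up.
  by rewrite !comp_assoc.
Qed.

End Transfer.

(** * Epimorphisms and cokernels of modules *)

Section ModuleCategory.
Variable R : pzRingType.
Local Notation Mod := (right_module_category R).

Lemma module_surj_epi (X Y : lmodType R^c) (f : {linear X -> Y}) :
  (forall y, exists x, f x = y) -> @epi Mod X Y f.
Proof.
move=> f_surj Z g h gh; apply: linear_ext => y; have [x <-] := f_surj y.
exact: (congr1 (fun u : {linear X -> Z} => u x) gh).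
Qed.

Lemma module_cokernel (X Y : lmodType R^c) (f : {linear X -> Y}) :
  let q := quotient_proj (submodule_image f) in
  @is_cokernel Mod X Y (quotient (submodule_image f)) f q.
Proof.
set im := submodule_image f; move=> /=; split.
  apply: linear_ext => x /=; rewrite -(linear0 (quotient_proj im)).
  by apply/quotient_proj_eq; rewrite subr0; exists x.
move=> Z g gf.
have [|y|h hE] := @factor_surj _ _ _ _ (quotient_proj im) g.
- exact: quotient_proj_surj.
- rewrite -(linear0 (quotient_proj im)) => /quotient_proj_eq.
  rewrite subr0 => -[x <-].
  exact: (congr1 (fun u : {linear X -> Z} => u x) gf).
exists h; split; first exact: linear_ext.
move=> h' h'E; apply: linear_ext => z; have [y <-] := quotient_proj_surj z.
rewrite hE; exact: (esym (congr1 (fun u : {linear Y -> Z} => u y) h'E)).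
Qed.

Lemma module_quotient0_surj (X Y : lmodType R^c) (f : {linear X -> Y}) :
  (forall y, quotient_proj (submodule_image f) y = 0) ->
  forall y, exists x, f x = y.
Proof.
move=> p0 y; have := p0 y; rewrite -(linear0 (quotient_proj (submodule_image f))).
by move/quotient_proj_eq; rewrite subr0.
Qed.

(** The projection onto [Y] modulo the image of [f] and the zero map agree after [f], hence are
    equal. *)
Lemma module_epi_surj (X Y : lmodType R^c) (f : {linear X -> Y}) :
  @epi Mod X Y f -> forall y, exists x, f x = y.
Proof.
move=> ef; apply: module_quotient0_surj => y.
have [pf _] := module_cokernel f.
have p0 := ef _ _ (@zerom Mod _ _) (etrans pf (esym (@comp_zerol Mod _ _ _ _))).
exact: (congr1 (fun v : {linear Y -> quotient (submodule_image f)} => v y) p0).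
Qed.

(** The projection onto [Y] modulo the image of [f] factors through the zero cokernel, so it
    vanishes. *)
Lemma module_cokernel0_epi (X Y Q : lmodType R^c) (f : {linear X -> Y}) :
  @is_cokernel Mod X Y Q f (@zerom Mod Y Q) -> @epi Mod X Y f.
Proof.
move=> [_ qU]; apply/module_surj_epi/module_quotient0_surj => y.
have [pf _] := module_cokernel f; have [u [u0 _]] := qU _ _ pf.
rewrite -(congr1 (fun v : {linear Y -> quotient (submodule_image f)} => v y) u0).
exact: linear0.
Qed.

End ModuleCategory.

(** * Naturality of the associativity map *)

Section TensorNaturality.
Variable k : fieldType.

Lemma eq_tmap (V V' W W' : lmodType k) (f f' : {linear V -> V'})
  (g g' : {linear W -> W'}) : f =1 f' -> g =1 g' -> tmap f g =1 tmap f' g'.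
Proof. by move=> /linear_ext -> /linear_ext ->. Qed.

Lemma tassoc_natural (U V W W' : lmodType k) (g : {linear W -> W'})
    (x : tensor (tensor U V) W) :
  tassoc (tmap idfun g x) = tmap idfun (tmap idfun g) (tassoc x).
Proof.
apply: (tens_ext (F := @tassoc _ U V W' \o tmap idfun g)
  (G := tmap idfun (tmap idfun g) \o @tassoc _ U V W)) => {}x w /=.
rewrite tmapE -(tens_sumK x) tens_sumE /= !tens_suml !linear_sum.
by apply: eq_bigr => p _; rewrite /= !tassocE !tmapE /= ?tmapE.
Qed.

End TensorNaturality.

(** * Subcomodules and quotient comodules *)

Section Subcomodules.
Variables (k : fieldType) (C : coalgebra k) (M : left_comodule C).

(** Stability under contractions replaces the condition that the coaction maps [H] into C (x) H;
    [tmap_im] recovers the latter. *)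
Definition subcomodule (H : M -> Prop) : Prop :=
  submodule H /\
  forall (f : {scalar C}) m, H m -> H (contract f (lcoact M m)).

(* The scalar [a] acts on a comodule as the element [a . counit] of C^*, so that
   C^*-linearity entails k-linearity. *)
Definition dual_scalar (a : k) (c : C) : k := a * counit C c.

Lemma dual_scalar_linear a : scalar (dual_scalar a).
Proof. by move=> b c c'; rewrite /dual_scalar linearP mulrDr mulrCA. Qed.

HB.instance Definition _ a :=
  GRing.isLinear.Build k C k *%R (dual_scalar a) (dual_scalar_linear a).

Lemma contract_dual_scalar a (m : M) :
  contract (dual_scalar a) (lcoact M m) = a *: m.
Proof.
rewrite -[m in RHS]lcoact1 -(tens_sumK (lcoact M m)) tens_sumE !linear_sum.
by apply: eq_bigr => p _; rewrite /= !contractE scalerA.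
Qed.

Lemma rational_submodule (H : M -> Prop) :
  @submodule (dual_algebra C)^c (rational_module M) H -> subcomodule H.
Proof.
case=> H0 HL.
have Hact (f : {scalar C}) m : H m -> H (contract f (lcoact M m)).
  by move=> Hm; have := HL (f : dual_algebra C) m 0 Hm H0; rewrite addr0.
split=> //; split=> // a u v Hu Hv.
rewrite -(contract_dual_scalar a u).
by have := HL (dual_scalar a : {scalar C}) u v Hu Hv.
Qed.

Variables (H : M -> Prop) (subH : subcomodule H).
Let submodH : submodule H := subH.1.

Local Notation ker := (quotient submodH).
Local Notation proj := (quotient_proj submodH).

(** The coaction followed by the projection kills [H]: its contractions at an element of [H] are
    classes of elements of [H], hence zero. *)
Lemma exists_quotient_coact : exists d : {linear ker -> tensor C ker},
  forall m, d (proj m) = tmap idfun proj (lcoact M m).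
Proof.
apply: (factor_surj (g := tmap idfun proj \o lcoact M)).
  exact: quotient_proj_surj.
move=> m; rewrite -(linear0 proj) => /quotient_proj_eq; rewrite subr0 => Hm.
apply: contract_eq0 => f /=; rewrite contract_tmap -(linear0 proj).
apply/quotient_proj_eq; rewrite subr0; exact: subH.2.
Qed.

Definition quotient_coact := projT1 (cid exists_quotient_coact).

Lemma quotient_coactE m :
  quotient_coact (proj m) = tmap idfun proj (lcoact M m).
Proof. by rewrite /quotient_coact; case: cid. Qed.

Lemma quotient_coactA x :
  tassoc (tmap (comul C) idfun (quotient_coact x)) =
  tmap idfun quotient_coact (quotient_coact x).
Proof.
have [m <-] := quotient_proj_surj x; rewrite quotient_coactE !tmap_comp.
(* Both sides are the image under the projection of the coassociativity identity of [M] at [m]. *)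
transitivity (tmap idfun (tmap idfun proj) (tmap idfun (lcoact M) (lcoact M m))).
  by rewrite -lcoactA -tassoc_natural tmap_comp; congr tassoc; apply: eq_tmap.
by rewrite tmap_comp; apply: eq_tmap => // {}m /=; rewrite quotient_coactE.
Qed.

Lemma quotient_coact1 x : contract (counit C) (quotient_coact x) = x.
Proof.
have [m <-] := quotient_proj_surj x.
by rewrite quotient_coactE contract_tmap lcoact1.
Qed.

Definition quotient_comodule : left_comodule C :=
  LeftComodule quotient_coactA quotient_coact1.

Definition quotient_comodule_proj : lhom M quotient_comodule :=
  @Lhom _ _ M quotient_comodule proj quotient_coactE.

Local Notation sub := (subobject submodH).

Definition sub_incl (s : sub) : M := \val s.

Lemma sub_incl_linear : linear sub_incl.
Proof. exact: linearP. Qed.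

HB.instance Definition _ :=
  GRing.isLinear.Build k sub M *:%R sub_incl sub_incl_linear.

Lemma sub_inclP s : H (sub_incl s).
Proof. by have /asboolP := valP s. Qed.

Lemma sub_incl_surj m : H m -> exists s, sub_incl s = m.
Proof.
move=> Hm; have Sm : submodule_mem submodH m by exact/asboolP.
by exists (Sub m Sm); exact: SubK.
Qed.

Lemma sub_incl_inj : injective sub_incl.
Proof. exact: val_inj. Qed.

Lemma exists_sub_coact s : exists x, tmap (idfun : {linear C -> C}) sub_incl x =
  lcoact M (sub_incl s).
Proof.
apply: tmap_im => f; apply: sub_incl_surj.
exact: subH.2 (sub_inclP s).
Qed.

Definition sub_coact s := projT1 (cid (exists_sub_coact s)).

Lemma sub_coactE s : tmap idfun sub_incl (sub_coact s) = lcoact M (sub_incl s).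
Proof. by rewrite /sub_coact; case: cid. Qed.

(** The chosen preimages are unique because [tmap idfun sub_incl] is injective, so linearity is
    inherited from [lcoact M]. *)
Lemma sub_coact_linear : linear sub_coact.
Proof.
move=> a s t; apply: (tmap_inj sub_incl_inj).
by rewrite sub_coactE !linearP /= !sub_coactE.
Qed.

HB.instance Definition _ :=
  GRing.isLinear.Build k sub (tensor C sub) *:%R sub_coact sub_coact_linear.

Lemma sub_coactA s :
  tassoc (tmap (comul C) idfun (sub_coact s)) =
  tmap idfun sub_coact (sub_coact s).
Proof.
(* The identity is checked in C (x) (C (x) M), where it is coassociativity of [M]. *)
apply: (tmap_inj (tmap_inj sub_incl_inj)).
rewrite -tassoc_natural !tmap_comp.
transitivity (tassoc (tmap (comul C) idfun (tmap idfun sub_incl (sub_coact s)))).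
  by rewrite tmap_comp; congr tassoc; apply: eq_tmap.
rewrite sub_coactE lcoactA -sub_coactE tmap_comp.
by apply: eq_tmap => // t /=; rewrite sub_coactE.
Qed.

Lemma sub_coact1 s : contract (counit C) (sub_coact s) = s.
Proof.
by apply: sub_incl_inj; rewrite -contract_tmap sub_coactE lcoact1.
Qed.

Definition sub_comodule : left_comodule C := LeftComodule sub_coactA sub_coact1.

Definition sub_comodule_incl : lhom sub_comodule M :=
  @Lhom _ _ sub_comodule M sub_incl (fun s => esym (sub_coactE s)).

End Subcomodules.

(** * The inclusion of comodules into modules meets the transfer conditions *)

Section Inclusion.
Variables (k : fieldType) (C : coalgebra k).
Local Notation Com := (left_comodule_category C).
Local Notation Mod := (right_module_category (dual_algebra C)).
Local Notation i := (inclusion C).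

(** C^*-linearity says that [g] commutes with contractions of the coactions. The functionals
    [dual_scalar a] then give k-linearity, and [contract_inj] compatibility with the coactions. *)
Lemma inclusion_full (M N : Com) (g : Hom (i M) (i N)) :
  exists f : Hom M N, Fmap i f = g.
Proof.
pose gl : {linear rational_module M -> rational_module N} := g.
pose h (m : M) : N := gl m.
have hact (f : {scalar C}) m :
    h (contract f (lcoact M m)) = contract f (lcoact N (h m)).
  (* Scaling by [f] in a rational module is by definition the contraction of the coaction. *)
  have : gl ((f : (dual_algebra C)^c) *: (m : rational_module M)) =
    (f : (dual_algebra C)^c) *: gl m by rewrite linearZ.
  by [].
have h_lin : linear h.
  move=> a m m'; rewrite -(contract_dual_scalar a (h m)) -hact.
  rewrite contract_dual_scalar.
  exact: (linearD gl).
pose hL : {linear M -> N} := HB.pack h (GRing.isLinear.Build k M N *:%R h h_lin).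
have hP : lcomodule_hom hL.
  by move=> m; apply: contract_inj => f; rewrite contract_tmap -hact.
by exists (Lhom hP); apply: linear_ext.
Qed.

Lemma inclusion_faithful (M N : Com) (f g : Hom M N) :
  Fmap i f = Fmap i g -> f = g.
Proof.
move=> fg; apply: lhom_ext => m.
exact: (congr1 (fun u : {linear rational_module M -> rational_module N} => u m) fg).
Qed.

Lemma inclusion_zero (M N : Com) : Fmap i (zerom M N) = zerom (i M) (i N).
Proof. exact: linear_ext. Qed.

Lemma module_iso (X Y : lmodType (dual_algebra C)^c) (u : {linear X -> Y}) :
  injective u -> (forall y, exists x, u x = y) ->
  exists v : {linear Y -> X},
    @comp Mod X Y X v u = @idm Mod X /\ @comp Mod Y X Y u v = @idm Mod Y.
Proof.
move=> u_inj u_surj.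
have [x|v vu] := factor_surj u_surj (g := idfun).
  by rewrite -(linear0 u) => /u_inj ->.
exists v; split; apply: linear_ext => x //=.
by have [x' <-] := u_surj x; rewrite vu.
Qed.

(** The kernel of [e] is a C^*-submodule, hence a subcomodule, and the quotient comodule is
    isomorphic to [Y] as [e] is surjective. *)
Lemma inclusion_quotient (M : Com) (Y : Mod) (e : Hom (i M) Y) : epi e ->
  exists (Q : Com) (p : Hom M Q) (u : Hom (i Q) Y) (v : Hom Y (i Q)),
    [/\ v \oc u = idm (i Q), u \oc v = idm Y & u \oc Fmap i p = e].
Proof.
pose el : {linear rational_module M -> Y} := e.
move=> /module_epi_surj e_surj.
have sub_ker : @submodule (dual_algebra C)^c (rational_module M) (fun m => el m = 0).
  split; first exact: linear0.
  by move=> a u v u0 v0; rewrite linearP u0 v0 scaler0 addr0.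
pose subK := rational_submodule sub_ker.
pose p : lhom M (quotient_comodule subK) := quotient_comodule_proj subK.
pose pR : {linear rational_module M -> rational_module (quotient_comodule subK)} :=
  rational_map p.
have p_surj : forall x, exists m, pR m = x by exact: quotient_proj_surj.
have p_eq m m' : pR m = pR m' <-> el (m - m') = 0 by exact: quotient_proj_eq.
have [m|u up] := @factor_surj _ _ _ _ pR el p_surj.
  by rewrite -(linear0 pR) => /p_eq; rewrite subr0.
have [|y|v [vu uv]] := module_iso (u := u).
- move=> x y; have [m <-] := p_surj x; have [m' <-] := p_surj y.
  by rewrite !up => mm'; apply/p_eq; rewrite linearB mm' subrr.
- by have [m <-] := e_surj y; exists (pR m); exact: up.
exists (quotient_comodule subK), p, u, v; split=> //.
exact: linear_ext.
Qed.

(** The image of [h] is a C^*-submodule of a comodule, hence a subcomodule [S]. The corestriction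
    [e] is linear because the inclusion of [S] is injective. *)
Lemma inclusion_image (X : Mod) (N : Com) (h : Hom X (i N)) :
  exists (S : Com) (j : Hom S N) (e : Hom X (i S)),
    epi e /\ Fmap i j \oc e = h.
Proof.
pose hl : {linear (X : lmodType _) -> rational_module N} := h.
pose subI := rational_submodule (submodule_image hl).
pose j : lhom (sub_comodule subI) N := sub_comodule_incl subI.
pose jR : {linear rational_module (sub_comodule subI) -> rational_module N} :=
  rational_map j.
have j_inj : injective jR by exact: sub_incl_inj.
have j_im x : exists s, jR s = hl x by apply: sub_incl_surj; exists x.
pose e x := projT1 (cid (j_im x)).
have je x : jR (e x) = hl x by rewrite /e; case: cid.
have e_lin : linear e.
  by move=> a x y; apply: j_inj; rewrite linearP !je linearP.
pose eL : {linear (X : lmodType _) -> rational_module (sub_comodule subI)} :=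
  HB.pack e (GRing.isLinear.Build _ _ _ *:%R e e_lin).
exists (sub_comodule subI), j, eL; split; last exact: linear_ext.
apply: module_surj_epi => s; have [x xs] := sub_inclP s.
by exists x; apply: j_inj; rewrite je.
Qed.

End Inclusion.

Theorem corollary4p3 (k : fieldType) (C : coalgebra k)
    (hC : right_semiperfect C) (M N : left_comodule_category C) :
  dual_CS_Rickart M N <->
  dual_CS_Rickart (inclusion C M) (inclusion C N).
Proof.
apply: dual_CS_Rickart_transfer.
- exact: inclusion_full.
- exact: inclusion_faithful.
- exact: inclusion_zero.
- by move=> X Y f; do 2 eexists; exact: module_cokernel.
- exact: module_cokernel0_epi.
- exact: inclusion_quotient.
- exact: inclusion_image.
Qed.
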